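(* Let $\mathbf{f}(\mathbf{x})=\{f_1(\mathbf{x}),\dots,f_n(\mathbf{x})\}\subset\mathbb{R}[x_1,\dots,x_n]$ be a zero-dimensional smooth complete intersection. Let $p$ be a nonsingular real solution of $\mathbf{f}(\mathbf{x})=0$, let $r_1\ge 1$, $r_2\ge 1$ be real numbers such that $\frac{1}{r_1}+\frac{1}{r_2}=1$, including the pairs $(1,\infty)$ and $(\infty,1)$, let $\gamma=(\gamma_1,\dots,\gamma_n)$ be an $n$-tuple of nonzero real numbers, and let $\mathbf{g}_\gamma(\mathbf{x})$, $\mathbf{u}(\mathbf{x})$ be the polynomial systems defined by $\mathbf{g}_\gamma(\mathbf{x})=\{\gamma_1f_1(\mathbf{x}),\dots,\gamma_nf_n(\mathbf{x})\}$ and $\mathbf{u}(\mathbf{x})=\{\|\frac{\partial f_1}{\partial\mathbf{x}}(p)\|_{r_2}^{-1}f_1(\mathbf{x}),\dots,\|\frac{\partial f_n}{\partial\mathbf{x}}(p)\|_{r_2}^{-1}f_n(\mathbf{x})\}$. (a) We have the inequality $\kappa_{r_1}(\mathbf{u},p)\le n^{1/r_1}\,\kappa_{r_1}(\mathbf{g}_\gamma,p)$. (b) In particular, if $(r_1,r_2)=(\infty,1)$ we have the equality $$\kappa_\infty(\mathbf{u},p)=\min_\gamma\kappa_\infty(\mathbf{g}_\gamma,p),$$ where $\mathbf{u}(\mathbf{x})=\{\|\frac{\partial f_1}{\partial\mathbf{x}}(p)\|_1^{-1}f_1(\mathbf{x}),\dots,\|\frac{\partial f_n}{\partial\mathbf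{x}}(p)\|_1^{-1}f_n(\mathbf{x})\}$.
   Context: A set $\mathbf{f}=\{f_1,\dots,f_n\}\subset\mathbb{R}[x_1,\dots,x_n]$ generating an ideal $I$ is a zero-dimensional complete intersection if $\dim(\mathbb{R}[\mathbf{x}]/I)=0$; it is smooth if the scheme it defines is smooth. A solution $p$ is nonsingular if the Jacobian matrix $\mathrm{Jac}_{\mathbf{f}}(p)$ is invertible. $\frac{\partial f_i}{\partial\mathbf{x}}(p)$ is the gradient vector of $f_i$ at $p$ (the $i$-th row of $\mathrm{Jac}_{\mathbf{f}}(p)$). For $r\ge1$, $\|v\|_r=(\sum_i|v_i|^r)^{1/r}$, $\|v\|_\infty=\max_i|v_i|$, and $\|M\|_r=\max_{\|v\|_r=1}\|Mv\|_r$ is the induced matrix norm. The local condition number with respect to the $r$-norm of a system $\mathbf{g}$ of $n$ polynomials at a nonsingular real solution $p$ is $\kappa_r(\mathbf{g},p)=\|\mathrm{Jac}_{\mathbf{g}}(p)^{-1}\|_r\,\|\mathrm{Jac}_{\mathbf{g}}(p)\|_r$. Convention: $1/\infty=0$. The minimum in (b) is over all $n$-tuples $\gamma$ of nonzero real numbers. *)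

(* Defs.v *)
(* [mpoly] is not imported as a whole, because its notations clash with those
   of MathComp-Analysis. *)
From HB Require Import structures.
From mathcomp Require Import all_boot all_order all_algebra.
From mathcomp Require Import ring_quotient.
From mathcomp Require Import all_classical all_reals all_analysis.
From mathcomp Require mpoly.
Import (canonicals) mpoly.

Set Implicit Arguments.
Unset Strict Implicit.
Unset Printing Implicit Defensive.

Import Order.TTheory GRing.Theory Num.Theory.
Import numFieldNormedType.Exports.

Local Open Scope classical_set_scope.
Local Open Scope ring_scope.

(* R[x_1, ..., x_n] *)
Definition mpolys (R : realType) (n : nat) : comNzRingType := mpoly.mpoly n R.

(* A system of n polynomials in n variables; a system is a tuple, not a set,
   so that its members can be rescaled separately. *)
Definition system (R : realType) (n : nat) := 'I_n -> mpolys R n.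

Section Scheme.

Definition generated_ideal (A : comNzRingType) (n : nat) (f : 'I_n -> A) :
    set A :=
  [set h | exists q : 'I_n -> A, h = \sum_(i < n) q i * f i].

(* [idealr_closed] includes properness. *)
Definition is_prime_ideal (A : comNzRingType) (P : {pred A}) : Prop :=
  idealr_closed P /\ prime_idealr_closed P.

(* The primes of A / I are the primes of A containing I, so this is a strict
   chain P_0 < ... < P_d of prime ideals of A / I. *)
Definition quotient_prime_chain (A : comNzRingType) (I : set A) (d : nat)
    (P : nat -> {pred A}) : Prop :=
  [/\ forall k, (k <= d)%N -> is_prime_ideal (P k),
      forall h, I h -> h \in P 0%N &
      forall k, (k < d)%N ->
        {subset P k <= P k.+1} /\ ~ {subset P k.+1 <= P k}].

(* The Krull dimension of A / I is d; the zero ring has no dimension in nat. *)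
Definition quotient_krull_dim (A : comNzRingType) (I : set A) (d : nat) :
    Prop :=
  (exists P, quotient_prime_chain I d P) /\
  (forall k P, quotient_prime_chain I k P -> (k <= d)%N).

Definition zero_dim_complete_intersection (R : realType) (n : nat)
    (f : system R n) : Prop :=
  quotient_krull_dim (generated_ideal f) 0.

(* Zeros of f in an R-algebra C, that is, R-algebra morphisms from
   R[x] / (f_1, ..., f_n) to C, that is, C-points of the scheme of f. *)
Definition algebra_zero (R : realType) (n : nat) (f : system R n)
    (C : comAlgType R) (x : 'I_n -> C) : Prop :=
  forall i, mpoly.mmap (GRing.in_alg C) x (f i) = 0.

(* Smoothness of Spec (R[x] / (f_1, ..., f_n)) over R, in Grothendieck's sense
   (EGA IV 17.3.1): the scheme is of finite presentation, so it is smooth iff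
   its points lift along every surjection with square-zero kernel. *)
Definition smooth_system (R : realType) (n : nat) (f : system R n) : Prop :=
  forall (C D : comAlgType R) (pi : {lrmorphism C -> D}),
    (forall d : D, exists c : C, pi c = d) ->
    (forall a b : C, pi a = 0 -> pi b = 0 -> a * b = 0) ->
    forall y : 'I_n -> D, algebra_zero f y ->
    exists x : 'I_n -> C, (forall j, pi (x j) = y j) /\ algebra_zero f x.

End Scheme.

Section ConditionNumber.
Variables (R : realType) (n : nat).

Definition peval (q : mpolys R n) (p : 'I_n -> R) : R := mpoly.meval p q.

Definition gradient (q : mpolys R n) (p : 'I_n -> R) : 'cV[R]_n :=
  \col_j peval (mpoly.mderiv j q) p.

Definition jacobian (f : system R n) (p : 'I_n -> R) : 'M[R]_n :=
  \matrix_(i, j) gradient (f i) p j 0.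

Definition nonsingular_solution (f : system R n) (p : 'I_n -> R) : Prop :=
  (forall i, peval (f i) p = 0) /\ jacobian f p \in unitmx.

(* The r-norm for r in [1, +oo]; the value at -oo is junk. *)
Definition vnorm (r : \bar R) (v : 'cV[R]_n) : R :=
  match r with
  | s%:E => (\sum_(i < n) `|v i 0| `^ s) `^ s^-1
  | +oo%E => \big[Num.max/0]_(i < n) `|v i 0|
  | -oo%E => 0
  end.

(* The supremum is a maximum when 0 < n, since the unit sphere is compact. *)
Definition mxnorm (r : \bar R) (M : 'M[R]_n) : R :=
  sup [set vnorm r (M *m v) | v in [set v : 'cV[R]_n | vnorm r v = 1]].

(* [invmx] is the inverse only at a nonsingular solution. *)
Definition cond_number (r : \bar R) (g : system R n) (p : 'I_n -> R) : R :=
  mxnorm r (invmx (jacobian g p)) * mxnorm r (jacobian g p).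

Definition scaled_system (gamma : 'I_n -> R) (f : system R n) : system R n :=
  fun i => mpoly.mpolyC n (gamma i) * f i.

Definition normalized_system (r : \bar R) (f : system R n) (p : 'I_n -> R) :
    system R n :=
  scaled_system (fun i => (vnorm r (gradient (f i) p))^-1) f.

End ConditionNumber.

Definition is_minimum (R : realType) (A : set R) (m : R) : Prop :=
  A m /\ lbound A m.

(* Main.v *)
Require Import Defs.
From HB Require Import structures.
From mathcomp Require Import all_boot all_order all_algebra.
From mathcomp Require Import all_classical all_reals all_analysis.

Set Implicit Arguments.
Unset Strict Implicit.
Unset Printing Implicit Defensive.

Import Order.TTheory GRing.Theory Num.Theory.
Import numFieldNormedType.Exports.

Local Open Scope classical_set_scope.
Local Open Scope ring_scope.

(** Let J be the Jacobian matrix of f at p, a unit, and let N_i be the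
    r2-norm of its i-th row. Scaling the equations of f scales the rows of J,
    so the statement is about matrices only: dividing each row of J by its
    norm N_i is, up to the factor n^(1/r1), the best row scaling for the
    condition number in the r1-norm ([equilibration]).

    Let E be the matrix with rows J_i / N_i and let G be diag(gamma) J. Two
    facts on conjugate exponents give the result.
    - By Hoelder's inequality, a matrix with rows of r2-norm at most 1 maps
      the r1-unit sphere into the cube [-1, 1]^n, on which the r1-norm is at
      most n^(1/r1). Hence the norm of E is at most n^(1/r1)
      ([mxnorm_le_card]).
    - Hoelder's inequality is sharp: some v of r1-norm 1 satisfies
      G_i v = ||G_i||_r2, and the coordinate (G v)_i is at most the norm of G.
      So |gamma_i| N_i <= ||G|| for each i ([row_le_mxnorm]).
    Since E^-1 = G^-1 diag(gamma_i N_i), the second fact bounds the norm of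
    E^-1 by ||G^-1|| max_i |gamma_i| N_i <= ||G^-1|| ||G||, which is the
    condition number of G. The product of the two bounds is part (a). For
    r1 = oo the factor n^(1/r1) is 1, and E itself is the scaling with
    gamma_i = 1 / N_i, so the minimum in part (b) is attained. *)

(** * The r-norm of a vector *)

Section VectorNorm.
Variables (R : realType) (n : nat).
Implicit Types (r : \bar R) (s t : R) (a v w : 'cV[R]_n).

Lemma powRK s (x : R) : 0 <= x -> s != 0 -> (x `^ s) `^ s^-1 = x.
Proof. by move=> x0 s0; rewrite -powRrM mulfV// powRr1. Qed.

Lemma vnorm_ge0 r v : 0 <= vnorm r v.
Proof. by case: r => [s| |] //=; [exact: powR_ge0 | exact: bigmax_ge_id]. Qed.

Lemma vnorm_fin_powR s v : 0 < s ->
  vnorm s%:E v `^ s = \sum_(i < n) `|v i 0| `^ s.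
Proof.
move=> s0 /=; rewrite -powRrM mulVf ?gt_eqF// powRr1//.
by apply: sumr_ge0 => i _; exact: powR_ge0.
Qed.

Lemma ler_vnorm r v w : (1 <= r)%E -> (forall i, `|v i 0| <= `|w i 0|) ->
  vnorm r v <= vnorm r w.
Proof.
case: r => [s| |]; last by [].
  2: by move=> _ vw; apply: le_bigmax2 => i _; exact: vw.
rewrite lee_fin => s1 vw; have s0 : 0 <= s by exact: le_trans ler01 s1.
apply: ge0_ler_powR; rewrite ?nnegrE ?invr_ge0//.
- by apply: sumr_ge0 => i _; exact: powR_ge0.
- by apply: sumr_ge0 => i _; exact: powR_ge0.
- by apply: ler_sum => i _; apply: ge0_ler_powR; rewrite ?nnegrE.
Qed.

Lemma vnormZ r c v : (1 <= r)%E -> vnorm r (c *: v) = `|c| * vnorm r v.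
Proof.
case: r => [s| |] /=; last 1 first.
- by move=> _; rewrite mulr0.
- rewrite lee_fin => s1; have s0 : 0 < s by exact: lt_le_trans ltr01 s1.
  under eq_bigr => i _ do rewrite mxE normrM powRM//.
  rewrite -mulr_sumr powRM ?powR_ge0// ?powRK ?gt_eqF//.
  by apply: sumr_ge0 => i _; exact: powR_ge0.
- move=> _; under eq_bigr => i _ do rewrite mxE normrM.
  apply/le_anti/andP; split.
    apply: bigmax_le; first by rewrite mulr_ge0 ?bigmax_ge_id.
    by move=> i _; rewrite ler_wpM2l// (le_bigmax _ (fun i => `|v i 0|)).
  have [->|c0] := eqVneq c 0; first by rewrite normr0 mul0r bigmax_ge_id.
  rewrite mulrC -ler_pdivlMr ?normr_gt0//; apply: bigmax_le.
    by rewrite divr_ge0// bigmax_ge_id.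
  move=> i _; rewrite ler_pdivlMr ?normr_gt0// mulrC.
  exact: (le_bigmax _ (fun i => `|c| * `|v i 0|)).
Qed.

Lemma ler_coord_vnorm r v i : (1 <= r)%E -> `|v i 0| <= vnorm r v.
Proof.
case: r => [s| |]; last by [].
  2: by move=> _; exact: (le_bigmax _ (fun i => `|v i 0|)).
rewrite lee_fin => s1; have s0 : 0 < s by exact: lt_le_trans ltr01 s1.
rewrite -[leLHS](@powRK s) ?gt_eqF//.
apply: ge0_ler_powR; rewrite ?nnegrE ?invr_ge0 ?powR_ge0 ?(ltW s0)//.
  by apply: sumr_ge0 => j _; exact: powR_ge0.
by rewrite (bigD1 i)//= lerDl sumr_ge0// => j _; exact: powR_ge0.
Qed.

Lemma vnorm_eq0 r v : (1 <= r)%E -> vnorm r v = 0 -> v = 0.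
Proof.
move=> r1 v0; apply/colP => i; rewrite mxE; apply/eqP.
by rewrite -normr_le0 -v0 ler_coord_vnorm.
Qed.

Lemma vnorm_le_card r v : (1 <= r)%E -> (forall i, `|v i 0| <= 1) ->
  vnorm r v <= n%:R `^ fine (r^-1)%E.
Proof.
case: r => [s| |]; last by [].
  2: by move=> _ v1; rewrite invey powRr0; apply: bigmax_le => // i _; exact: v1.
rewrite lee_fin => s1 v1; have s0 : 0 < s by exact: lt_le_trans ltr01 s1.
rewrite fine_invr; apply: ge0_ler_powR; rewrite ?nnegrE ?invr_ge0 ?(ltW s0)//.
  by apply: sumr_ge0 => i _; exact: powR_ge0.
rewrite -[n in leRHS]card_ord -sum1_card natr_sum; apply: ler_sum => i _.
have one_pow : 1 = 1 `^ s :> R by rewrite powR1.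
by rewrite [leRHS]one_pow ge0_ler_powR ?nnegrE ?(ltW s0).
Qed.

End VectorNorm.

(** * Duality of conjugate norms *)

Section Duality.
Variables (R : realType) (n : nat).
Implicit Types (r : \bar R) (s t : R) (a v w : 'cV[R]_n).

(** The conjugate pairs, with the two endpoint pairs split off because the sup
    norm and the sum norm call for different arguments. *)
Variant conjugate_spec : \bar R -> \bar R -> Prop :=
| ConjugateFin s t of 1 < s & 1 < t & s^-1 + t^-1 = 1 :
    conjugate_spec s%:E t%:E
| Conjugate1y : conjugate_spec 1%E +oo%E
| Conjugatey1 : conjugate_spec +oo%E 1%E.

Lemma conjugateP r1 r2 : (1 <= r1)%E -> (1 <= r2)%E ->
  (r1^-1 + r2^-1)%E = 1%E -> conjugate_spec r1 r2.
Proof.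
have inv_fin s : 1 <= s -> (s%:E^-1 = s^-1%:E)%E.
  by move=> s1; rewrite inver gt_eqF// (lt_le_trans ltr01).
case: r1 => [s| |] //; case: r2 => [t| |] //; rewrite ?lee_fin.
- move=> s1 t1; rewrite !inv_fin// -EFinD => -[st].
  have si : 0 < s^-1 by rewrite invr_gt0 (lt_le_trans ltr01).
  have ti : 0 < t^-1 by rewrite invr_gt0 (lt_le_trans ltr01).
  apply: ConjugateFin => //; rewrite -invf_lt1 ?(lt_le_trans ltr01)//.
    by rewrite -st ltrDl.
  by rewrite -st ltrDr.
- move=> s1 _; rewrite invey adde0 => /eqP; rewrite inve_eq1 => /eqP ->.
  exact: Conjugate1y.
- move=> _ t1; rewrite invey add0e => /eqP; rewrite inve_eq1 => /eqP ->.
  exact: Conjugatey1.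
- by move=> _ _; rewrite invey adde0 => -[] /eqP; rewrite eq_sym oner_eq0.
Qed.

Lemma vnorm1 v : vnorm 1%E v = \sum_(i < n) `|v i 0|.
Proof.
rewrite /= invr1 powRr1; last by apply: sumr_ge0 => i _; exact: powR_ge0.
by apply: eq_bigr => i _; rewrite powRr1.
Qed.

(** For unit vectors, Young's inequality in each coordinate sums to
    1/t + 1/s = 1. *)
Lemma hoelder_unit s t a v : 1 < s -> 1 < t -> s^-1 + t^-1 = 1 ->
  vnorm t%:E a = 1 -> vnorm s%:E v = 1 -> \sum_(i < n) `|a i 0| * `|v i 0| <= 1.
Proof.
move=> s1 t1 st a1 v1.
have s0 : 0 < s := lt_trans ltr01 s1.
have t0 : 0 < t := lt_trans ltr01 t1.
apply: (@le_trans _ _ (\sum_(i < n) (`|a i 0| `^ t / t + `|v i 0| `^ s / s))).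
  by apply: ler_sum => i _; apply: conjugate_powR => //; rewrite addrC.
by rewrite big_split/= -!mulr_suml -!vnorm_fin_powR// a1 v1 !powR1 !mul1r addrC st.
Qed.

(** The finite case reduces by homogeneity to unit vectors; at the endpoints
    each coordinate of one vector is bounded by its sup norm. *)
Lemma hoelder r1 r2 a v : (1 <= r1)%E -> (1 <= r2)%E ->
  (r1^-1 + r2^-1)%E = 1%E ->
  \sum_(i < n) `|a i 0| * `|v i 0| <= vnorm r2 a * vnorm r1 v.
Proof.
move=> r11 r21 r12; have r12P := conjugateP r11 r21 r12.
case: r1 r2 / r12P r11 r21 {r12}.
- move=> s t s1 t1 st s1' t1'.
  have [a0|a0] := eqVneq (vnorm t%:E a) 0.
    rewrite a0 mul0r (vnorm_eq0 t1' a0) big1// => i _.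
    by rewrite mxE normr0 mul0r.
  have [v0|v0] := eqVneq (vnorm s%:E v) 0.
    rewrite v0 mulr0 (vnorm_eq0 s1' v0) big1// => i _.
    by rewrite mxE normr0 mulr0.
  have unitE r w : (1 <= r)%E -> vnorm r w != 0 ->
      vnorm r ((vnorm r w)^-1 *: w) = 1.
    by move=> r1 w0; rewrite vnormZ// normfV ger0_norm ?vnorm_ge0// mulVf.
  have := hoelder_unit s1 t1 st (unitE _ _ t1' a0) (unitE _ _ s1' v0).
  have : 0 < vnorm s%:E v by rewrite lt_neqAle eq_sym v0 vnorm_ge0.
  have : 0 < vnorm t%:E a by rewrite lt_neqAle eq_sym a0 vnorm_ge0.
  move: (vnorm t%:E a) (vnorm s%:E v) => A V A0 V0.
  have coordE i : `|(A^-1 *: a) i 0| * `|(V^-1 *: v) i 0| =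
      (A * V)^-1 * (`|a i 0| * `|v i 0|).
    by rewrite !mxE !normrM (gtr0_norm (_ : 0 < A^-1)) ?invr_gt0//
      (gtr0_norm (_ : 0 < V^-1)) ?invr_gt0// mulrACA invfM.
  rewrite (eq_bigr _ (fun i _ => coordE i)) -mulr_sumr mulrC.
  by rewrite ler_pdivrMr ?mul1r// mulr_gt0.
- move=> r1 ry; rewrite vnorm1 mulr_sumr; apply: ler_sum => i _.
  by rewrite ler_wpM2r// ler_coord_vnorm.
- move=> ry r1; rewrite vnorm1 mulr_suml; apply: ler_sum => i _.
  by rewrite ler_wpM2l// ler_coord_vnorm.
Qed.

(** Hoelder's inequality is attained. The extremal v has the signs of a; its
    absolute values are proportional to |a_i|^(t-1) for finite exponents, are
    concentrated on a largest coordinate of a for the pair (1, oo), and are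
    all 1 (where a does not vanish) for the pair (oo, 1). *)
Lemma dual_vector r1 r2 a : (1 <= r1)%E -> (1 <= r2)%E ->
  (r1^-1 + r2^-1)%E = 1%E -> a != 0 ->
  exists2 v, vnorm r1 v = 1 & \sum_(i < n) a i 0 * v i 0 = vnorm r2 a.
Proof.
move=> r11 r21 r12 a0.
have A0 : 0 < vnorm r2 a.
  rewrite lt_neqAle eq_sym vnorm_ge0 andbT.
  by apply: contra_neq a0 => /vnorm_eq0; exact.
have sgM (x : R) : x * Num.sg x = `|x| by rewrite mulrC -normrEsg.
have r12P := conjugateP r11 r21 r12.
case: r1 r2 / r12P r11 A0 {r12 r21}.
- move=> s t s1 t1 st s1'.
  have s0 : 0 < s := lt_trans ltr01 s1.
  have t0 : 0 < t := lt_trans ltr01 t1.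
  move: (vnorm t%:E a) (vnorm_fin_powR a t0) => A AE A0.
  (* This is the conjugacy relation in the form that turns the s-th power of
     |a_i|^(t-1) into |a_i|^t. *)
  have tsE : (t - 1) * s = t.
    have := congr1 (fun x => x * (s * t)) st.
    rewrite mul1r mulrDl mulrA mulVf ?gt_eqF// mul1r (mulrC s) mulrA mulVf ?gt_eqF//.
    by rewrite mul1r mulrBl mul1r => <-; rewrite addrK.
  pose u : 'cV[R]_n := \col_i (Num.sg (a i 0) * `|a i 0| `^ (t - 1)).
  have uE : vnorm s%:E u = A `^ (t - 1).
    rewrite /vnorm; under eq_bigr => i _.
      rewrite mxE normrM normr_sg ger0_norm ?powR_ge0//.
      have -> : ((a i 0 != 0)%:R * `|a i 0| `^ (t - 1)) `^ s = `|a i 0| `^ t.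
        have [->|_] := eqVneq (a i 0) 0; last by rewrite mul1r -powRrM tsE.
        by rewrite mul0r normr0 !powR0 ?gt_eqF.
      over.
    rewrite -AE -powRrM; congr (_ `^ _).
    by rewrite -[in LHS]tsE mulfK ?gt_eqF.
  exists ((A `^ (t - 1))^-1 *: u).
    by rewrite vnormZ// uE ger0_norm ?invr_ge0 ?powR_ge0// mulVf// gt_eqF// powR_gt0.
  under eq_bigr => i _.
    rewrite !mxE mulrCA (mulrA (a i 0)) sgM mulr_powRB1//.
    over.
  rewrite -mulr_sumr -AE -(mulr_powRB1 (ltW A0) t0).
  by rewrite mulrCA mulVf ?mulr1// gt_eqF// powR_gt0.
- move=> r1 A0.
  have [i ai] : exists i, vnorm +oo%E a = `|a i 0|.
    have [i _] : exists2 i, true & vnorm +oo%E a <= `|a i 0|.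
      have := lexx (vnorm +oo%E a); rewrite {2}/vnorm => /bigmax_geP[|//].
      by rewrite leNgt A0.
    by move=> ai; exists i; apply/le_anti; rewrite ai ler_coord_vnorm ?leey.
  have ai0 : a i 0 != 0 by rewrite -normr_gt0 -ai.
  exists (\col_j (Num.sg (a i 0) *+ (j == i))).
    rewrite vnorm1 (bigD1 i)//= mxE eqxx mulr1n normr_sg ai0 big1 ?addr0//.
    by move=> j ji; rewrite mxE (negbTE ji) mulr0n normr0.
  rewrite (bigD1 i)//= mxE eqxx mulr1n sgM big1 ?addr0 ?ai//.
  by move=> j ji; rewrite mxE (negbTE ji) mulr0n mulr0.
- move=> ry A0; exists (\col_i Num.sg (a i 0)); last first.
    by rewrite vnorm1; apply: eq_bigr => i _; rewrite mxE sgM.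
  apply/le_anti/andP; split.
    apply: bigmax_le => // i _.
    by rewrite mxE normr_sg; case: (a i 0 != 0); rewrite ?ler01.
  have [i ai0] : exists i, a i 0 != 0.
    apply: contrapT => /forallNP h; case/negP: a0; apply/eqP/colP => i.
    by rewrite mxE; apply/eqP/negPn/negP; exact: h.
  apply: le_trans (@ler_coord_vnorm _ _ _ _ i ry).
  by rewrite mxE normr_sg ai0.
Qed.

End Duality.

(** * The induced matrix norm *)

Section MatrixNorm.
Variables (R : realType) (n : nat).
Implicit Types (r : \bar R) (M A : 'M[R]_n) (v : 'cV[R]_n).

(** This holds even where the set is empty or unbounded, because its supremum
    is then 0. *)
Lemma mxnorm_ge0 r M : 0 <= mxnorm r M.
Proof.
rewrite /mxnorm; set S := [set _ | _ in _].
have [S_sup|/sup_out ->//] := pselect (has_sup S).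
have [[x Sx] S_ub] := S_sup; apply: le_trans (ub_le_sup S_ub Sx).
by case: Sx => v _ <-; exact: vnorm_ge0.
Qed.

(** The bound [c] has to be nonnegative for n = 0, when the unit sphere is
    empty and the norm is 0. *)
Lemma mxnorm_le r M (c : R) : 0 <= c ->
  (forall v, vnorm r v = 1 -> vnorm r (M *m v) <= c) -> mxnorm r M <= c.
Proof.
move=> c0 Mc; rewrite /mxnorm; set S := [set _ | _ in _].
have [->|S0] := eqVneq S set0; first by rewrite sup0.
by apply: ge_sup; [exact/set0P | move=> _ [v v1 <-]; exact: Mc].
Qed.

(** The coordinates of a unit vector are at most 1, so those of M v are at
    most the absolute row sums of M. *)
Lemma mxnorm_has_ubound r M : (1 <= r)%E ->
  has_ubound [set vnorm r (M *m v) | v in [set v | vnorm r v = 1]].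
Proof.
move=> r1; exists (vnorm r (\col_i \sum_j `|M i j|)) => _ [v /= v1 <-].
apply: ler_vnorm => // i; rewrite !mxE.
apply: le_trans (ler_norm_sum _ _ _) (le_trans _ (ler_norm _)); apply: ler_sum => j _.
by rewrite normrM ler_piMr// -v1 ler_coord_vnorm.
Qed.

(** Normalizing v reduces to a point of the unit sphere, where the supremum is
    an upper bound because the set is bounded. *)
Lemma vnorm_mulmx_le r M v : (1 <= r)%E ->
  vnorm r (M *m v) <= mxnorm r M * vnorm r v.
Proof.
move=> r1; have [v0|v0] := eqVneq (vnorm r v) 0.
  by rewrite v0 mulr0 (vnorm_eq0 r1 v0) mulmx0 -(scale0r 0) vnormZ// normr0 mul0r.
have V0 : 0 < vnorm r v by rewrite lt_neqAle eq_sym v0 vnorm_ge0.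
rewrite -ler_pdivrMr// mulrC.
have -> : (vnorm r v)^-1 * vnorm r (M *m v) =
    vnorm r (M *m ((vnorm r v)^-1 *: v)).
  by rewrite -scalemxAr vnormZ// gtr0_norm ?invr_gt0.
apply: ub_le_sup; first exact: mxnorm_has_ubound.
exists ((vnorm r v)^-1 *: v) => //=.
by rewrite vnormZ// gtr0_norm ?invr_gt0// mulVf.
Qed.

Lemma mxnorm_mul_diag_le r M (d : 'rV[R]_n) (c : R) : (1 <= r)%E -> 0 <= c ->
  (forall i, `|d 0 i| <= c) -> mxnorm r (M *m diag_mx d) <= mxnorm r M * c.
Proof.
move=> r1 c0 dc; apply: mxnorm_le; first by rewrite mulr_ge0 ?mxnorm_ge0.
move=> v v1; rewrite -mulmxA; apply: le_trans (vnorm_mulmx_le _ _ r1) _.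
rewrite ler_wpM2l ?mxnorm_ge0//.
apply: (@le_trans _ _ (vnorm r (c *: v))).
  apply: ler_vnorm => // i; rewrite mul_diag_mx !mxE !normrM.
  by rewrite ler_wpM2r// (ger0_norm c0).
by rewrite vnormZ// ger0_norm// v1 mulr1.
Qed.

(** Evaluating A at the dual vector of its i-th row makes the i-th coordinate
    of the image equal to the norm of that row. *)
Lemma row_le_mxnorm r1 r2 A i : (1 <= r1)%E -> (1 <= r2)%E ->
  (r1^-1 + r2^-1)%E = 1%E -> vnorm r2 (row i A)^T <= mxnorm r1 A.
Proof.
move=> r11 r21 r12; have [->|a0] := eqVneq (row i A)^T 0.
  by rewrite -(scale0r 0) vnormZ// normr0 mul0r mxnorm_ge0.
have [v v1 <-] := dual_vector r11 r21 r12 a0.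
apply: (@le_trans _ _ (vnorm r1 (A *m v))); last first.
  by have := vnorm_mulmx_le A v r11; rewrite v1 mulr1.
apply: le_trans (ler_coord_vnorm _ i r11); rewrite mxE.
by under eq_bigr => j _ do rewrite !mxE; exact: ler_norm.
Qed.

(** Hoelder's inequality bounds every coordinate of A v by 1 when v is a unit
    vector. *)
Lemma mxnorm_le_card r1 r2 A : (1 <= r1)%E -> (1 <= r2)%E ->
  (r1^-1 + r2^-1)%E = 1%E -> (forall i, vnorm r2 (row i A)^T <= 1) ->
  mxnorm r1 A <= n%:R `^ fine (r1^-1)%E.
Proof.
move=> r11 r21 r12 A1; apply: mxnorm_le; first exact: powR_ge0.
move=> v v1; apply: vnorm_le_card => // i.
have := hoelder (row i A)^T v r11 r21 r12; rewrite v1 mulr1 => h.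
apply: le_trans (le_trans h (A1 i)); rewrite mxE.
apply: le_trans (ler_norm_sum _ _ _) _.
by apply: ler_sum => j _; rewrite !mxE normrM.
Qed.

End MatrixNorm.

(** * Row equilibration *)

Section Equilibration.
Variables (R : realType) (n : nat).
Implicit Types (r : \bar R) (A : 'M[R]_n) (d : 'rV[R]_n).

Definition mxcond r A : R := mxnorm r (invmx A) * mxnorm r A.

Lemma vnorm_row_diag r d A i : (1 <= r)%E ->
  vnorm r (row i (diag_mx d *m A))^T = `|d 0 i| * vnorm r (row i A)^T.
Proof.
move=> r1; rewrite -vnormZ//; congr vnorm; apply/colP => j.
by rewrite mul_diag_mx !mxE.
Qed.

Lemma unitmx_diag d : (forall i, d 0 i != 0) -> diag_mx d \in unitmx.
Proof.
move=> d0; rewrite unitmxE det_diag unitfE; apply/prodf_neq0 => i _; exact: d0.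
Qed.

Lemma vnorm_row_gt0 r A i : (1 <= r)%E -> A \in unitmx ->
  0 < vnorm r (row i A)^T.
Proof.
move=> r1 Au; rewrite lt_neqAle eq_sym vnorm_ge0 andbT.
apply/negP => /eqP/(vnorm_eq0 r1)/(congr1 trmx); rewrite trmxK trmx0 => Ai0.
have : (row i A *m invmx A) 0 i = 0 by rewrite Ai0 mul0mx mxE.
by rewrite -row_mul mulmxV// !mxE eqxx => /eqP; rewrite oner_eq0.
Qed.

(** The row scaling that gives all rows the same dual norm is optimal up to
    n^(1/r1): with G = diag(d) A, passing from d to it multiplies the norm of
    the inverse by at most ||G|| and brings the norm of the matrix down to at
    most n^(1/r1). *)
Lemma equilibration r1 r2 d A : (1 <= r1)%E -> (1 <= r2)%E ->
  (r1^-1 + r2^-1)%E = 1%E -> A \in unitmx -> (forall i, d 0 i != 0) ->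
  mxcond r1 (diag_mx (\row_i (vnorm r2 (row i A)^T)^-1) *m A)
    <= n%:R `^ fine (r1^-1)%E * mxcond r1 (diag_mx d *m A).
Proof.
move=> r11 r21 r12 Au d0; pose N : 'I_n -> R := fun i => vnorm r2 (row i A)^T.
rewrite -/N; set G := diag_mx d *m A; set E := _ *m A.
have N0 i : 0 < N i by exact: vnorm_row_gt0.
have Gu : G \in unitmx by rewrite unitmx_mul unitmx_diag.
have Eu : E \in unitmx.
  by rewrite unitmx_mul unitmx_diag// => i; rewrite mxE invr_eq0 gt_eqF ?N0.
(* E = diag(1 / (d_i N_i)) G, hence E^-1 is a column scaling of G^-1. *)
have invE : invmx E = invmx G *m diag_mx (\row_i (d 0 i * N i)).
  apply: (can_inj (mulmxK Eu)); rewrite mulVmx// -mulmxA.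
  rewrite [X in _ *m X]mulmxA mulmx_diag.
  rewrite (_ : \row_j _ = d) ?mulVmx//; apply/rowP => i.
  by rewrite !mxE mulfK ?gt_eqF ?N0.
rewrite /mxcond mulrC; apply: ler_pM; rewrite ?mxnorm_ge0//.
  apply: (mxnorm_le_card r11 r21 r12) => i.
  by rewrite vnorm_row_diag// mxE normfV gtr0_norm ?N0// mulVf ?gt_eqF ?N0.
rewrite invE; apply: mxnorm_mul_diag_le; rewrite ?mxnorm_ge0// => i.
rewrite mxE normrM (gtr0_norm (N0 i)) -vnorm_row_diag//.
exact: row_le_mxnorm r12.
Qed.

End Equilibration.

(** * Jacobians of rescaled systems *)

Lemma jacobian_scaled (R : realType) (n : nat) (gamma : 'I_n -> R)
    (f : system R n) (p : 'I_n -> R) :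
  Defs.jacobian (scaled_system gamma f) p =
  diag_mx (\row_i gamma i) *m Defs.jacobian f p.
Proof.
apply/matrixP => i j; rewrite mul_diag_mx !mxE /peval /scaled_system.
by rewrite mpoly.mul_mpolyC mpoly.mderivZ mpoly.mevalZ.
Qed.

Lemma gradientE (R : realType) (n : nat) (f : system R n) (p : 'I_n -> R) i :
  gradient (f i) p = (row i (Defs.jacobian f p))^T.
Proof. by apply/colP => j; rewrite !mxE. Qed.

Theorem proposition4p1 (R : realType) (n : nat) (f : system R n)
    (p : 'I_n -> R)
    (f_zero_dim : zero_dim_complete_intersection f)
    (f_smooth : smooth_system f)
    (p_sol : nonsingular_solution f p) :
  (forall (r1 r2 : \bar R) (gamma : 'I_n -> R),
     (1 <= r1)%E -> (1 <= r2)%E -> (r1^-1 + r2^-1)%E = 1%E ->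
     (forall i, gamma i != 0) ->
     cond_number r1 (normalized_system r2 f p) p
       <= n%:R `^ fine (r1^-1)%E * cond_number r1 (scaled_system gamma f) p)
  /\
  is_minimum
    [set cond_number +oo%E (scaled_system gamma f) p
       | gamma in [set gamma : 'I_n -> R | forall i, gamma i != 0]]
    (cond_number +oo%E (normalized_system 1%E f p) p).
Proof.
have [_ Ju] := p_sol.
have bound (r1 r2 : \bar R) (gamma : 'I_n -> R) :
    (1 <= r1)%E -> (1 <= r2)%E -> (r1^-1 + r2^-1)%E = 1%E ->
    (forall i, gamma i != 0) ->
    cond_number r1 (normalized_system r2 f p) p
      <= n%:R `^ fine (r1^-1)%E * cond_number r1 (scaled_system gamma f) p.
  move=> r11 r21 r12 gamma0; rewrite /cond_number /normalized_system.
  rewrite !jacobian_scaled.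
  have -> : \row_i (vnorm r2 (gradient (f i) p))^-1 =
      \row_i (vnorm r2 (row i (Defs.jacobian f p))^T)^-1.
    by apply/rowP => i; rewrite mxE gradientE [RHS]mxE.
  have gamma_row0 i : (\row_j gamma j) 0 i != 0 by rewrite mxE.
  exact: (equilibration r11 r21 r12 Ju gamma_row0).
split=> //; split.
  exists (fun i => (vnorm 1%E (gradient (f i) p))^-1) => // i.
  by rewrite invr_eq0 gradientE gt_eqF// vnorm_row_gt0.
move=> _ [gamma gamma0 <-].
(* For r1 = oo the factor is n^0 = 1. *)
have := bound +oo%E 1%E gamma; rewrite invey powRr0 mul1r; apply; rewrite ?leey//.
by rewrite inve1 add0e.
Qed.
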